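(* Let $\alpha$ and $\omega$ be an $R$-Cartan structure and an $(I,J,1)$-generalized Finsler structure, respectively, on the same 3-manifold $\Sigma$. Then there is a unique linear transformation $A:T^*\Sigma\to T^*\Sigma$ with $\omega=A\alpha$ subject to the Foliation Condition and the Identification Condition, and its matrix is $$\begin{pmatrix}\omega^1\\ \omega^2\\ \omega^3\end{pmatrix}=\begin{pmatrix}1&0&0\\ I&J&-1\\ 0&1&0\end{pmatrix}\begin{pmatrix}\alpha^1\\ \alpha^2\\ \alpha^3\end{pmatrix}.$$ That is, whenever $\alpha$ and $\omega$ satisfy these two conditions, $A$ is necessarily this matrix. In this case the $R$-Cartan structure must obey the condition $$R=-I_2+J_1+1 .$$
   Context: An $R$-Cartan structure on a 3-manifold $\Sigma$ ($R$ a smooth function) is a coframing $\alpha=(\alpha^1,\alpha^2,\alpha^3)$ with $d\alpha^1=\alpha^2\wedge\alpha^3$, $d\alpha^2=-\alpha^1\wedge\alpha^3$, $d\alpha^3=R\,\alpha^1\wedge\alpha^2$. An $(I,J,1)$-generalized Finsler structure ($I,J$ smooth functions) is a coframing $\omega=(\omega^1,\omega^2,\omega^3)$ with $d\omega^1=-I\omega^1\wedge\omega^3+\omega^2\wedge\omega^3$, $d\omega^2=-\omega^1\wedge\omega^3$, $d\omega^3=\omega^1\wedge\omega^2-J\omega^1\wedge\omega^3$. Subscripts denote directional derivatives with respect to $\alpha$: $df=f_1\alpha^1+f_2\alpha^2+f_3\alpha^3$. Foliation Condition: the foliation $\{\omega^1=0,\omega^3=0\}$ (the geodesic foliation of $\omega$)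 coincides with the foliation $\{\alpha^1=0,\alpha^2=0\}$ (the indicatrix foliation of $\alpha$). Identification Condition: $\omega^1=\alpha^1$ and $\omega^3=\alpha^2$. *)

(* Defs.v *)
From HB Require Import structures.
From mathcomp Require Import all_boot all_order all_algebra.
From mathcomp Require Import all_classical all_reals all_analysis.

Set Implicit Arguments.
Unset Strict Implicit.
Unset Printing Implicit Defensive.

Import Order.TTheory GRing.Theory Num.Theory.
Import numFieldNormedType.Exports.
Local Open Scope classical_set_scope.
Local Open Scope ring_scope.

Section Euclidean.
Context {K : realType} {n : nat}.
Implicit Types (U : set 'rV[K]_n) (f : 'rV[K]_n -> K).

Definition partial (i : 'I_n) f : 'rV[K]_n -> K := 'D_(delta_mx 0 i) f.

Fixpoint Ck_on (k : nat) U f : Prop :=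
  match k with
  | 0%N => forall x, U x -> {for x, continuous f}
  | k'.+1 => (forall x, U x -> differentiable f x) /\
             (forall i, Ck_on k' U (partial i f))
  end.

(* Meant for open U: differentiability at x refers to a neighbourhood of x. *)
Definition smooth_on U f : Prop := forall k, Ck_on k U f.

End Euclidean.

(* The values of chart_map outside chart_dom, and of chart_inv outside
   chart_img, are irrelevant. *)
Record chart (K : realType) (n : nat) (T : topologicalType) := Chart {
  chart_dom : set T;
  chart_img : set 'rV[K]_n;
  chart_map : T -> 'rV[K]_n;
  chart_inv : 'rV[K]_n -> T;
  chart_dom_open : open chart_dom;
  chart_img_open : open chart_img;
  chart_mapP : forall p, chart_dom p -> chart_img (chart_map p);
  chart_invP : forall x, chart_img x -> chart_dom (chart_inv x);
  chart_mapK : forall p, chart_dom p -> chart_inv (chart_map p) = p;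
  chart_invK : forall x, chart_img x -> chart_map (chart_inv x) = x;
  chart_map_cont : forall p, chart_dom p -> {for p, continuous chart_map};
  chart_inv_cont : forall x, chart_img x -> {for x, continuous chart_inv}
}.

Definition transition (K : realType) (n : nat) (T : topologicalType)
    (c d : chart K n T) : 'rV[K]_n -> 'rV[K]_n :=
  chart_map d \o chart_inv c.

Record manifold (K : realType) (n : nat) := Manifold {
  manifold_top :> topologicalType;
  manifold_hausdorff : hausdorff_space manifold_top;
  manifold_second_countable : @second_countable manifold_top;
  atlas : set (chart K n manifold_top);
  atlas_cover : forall p, exists c, atlas c /\ chart_dom c p;
  atlas_compat : forall c d, atlas c -> atlas d -> forall i : 'I_n,
    smooth_on (chart_img c `&` chart_inv c @^-1` chart_dom d)
              (fun x => transition c d x 0 i)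
}.

Section Manifold.
Context {K : realType} {n : nat} {M : manifold K n}.

Definition chart_at (p : M) : chart K n M := projT1 (cid (atlas_cover p)).

(* The tangent space at p is R^n (row vectors), a vector being given by its
   components in the chart chart_at p; the cotangent space is the dual space,
   a covector being given by its components in the same chart. Components in
   any other chart are obtained with the Jacobian of the transition map. *)
Definition tangent (p : M) : vectType K := 'rV[K]_n.
Definition cotangent (p : M) : vectType K := 'cV[K]_n.

Definition pairing (p : M) (w : cotangent p) (v : tangent p) : K :=
  ((v : 'rV_n) *m (w : 'cV_n)) 0 0.

Definition smooth_fun (f : M -> K) : Prop :=
  forall c, atlas c -> smooth_on (chart_img c) (f \o chart_inv c).

(* Components in the chart c of a covector at p; for p in chart_dom c. *)
Definition components (c : chart K n M) (p : M) (w : cotangent p) : 'cV[K]_n :=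
  'J (transition c (chart_at p)) (chart_map c p) *m (w : 'cV_n).

(* Sections of the cotangent bundle, not required to be smooth. *)
Definition one_form := forall p : M, cotangent p.

Definition local_expr (c : chart K n M) (a : one_form) (i : 'I_n)
    (x : 'rV[K]_n) : K :=
  components c (a (chart_inv c x)) i 0.

Definition smooth_form (a : one_form) : Prop :=
  forall c, atlas c -> forall i, smooth_on (chart_img c) (local_expr c a i).

(* An alternating bilinear form on tangent p, given by its matrix
   (b(d_i, d_j))_{i,j} in the chart chart_at p. *)
Definition two_covector (p : M) : vectType K := 'M[K]_n.

Definition wedge (p : M) (a b : cotangent p) : two_covector p :=
  (a : 'cV_n) *m (b : 'cV_n)^T - (b : 'cV_n) *m (a : 'cV_n)^T.

Definition differential (f : M -> K) (p : M) : cotangent p :=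
  \col_i partial i (f \o chart_inv (chart_at p)) (chart_map (chart_at p) p).

(* The value at p of da, computed in the chart chart_at p. The conventions for
   d and wedge agree: d(x_i dx_j) = dx_i /\ dx_j, whose value on (d_i, d_j)
   is 1 for i <> j. *)
Definition ext_deriv (a : one_form) (p : M) : two_covector p :=
  let c := chart_at p in
  \matrix_(i, j) (partial i (local_expr c a j) (chart_map c p)
                  - partial j (local_expr c a i) (chart_map c p)).

Definition coframing (a : 'I_n -> one_form) : Prop :=
  (forall i, smooth_form (a i)) /\
  (forall p, basis_of fullv [tuple a i p | i < n]).

Definition coframe_mx (a : 'I_n -> one_form) (p : M) : 'M[K]_n :=
  \matrix_(i, j) (a j p : 'cV_n) i 0.

(* The j-th vector of the frame dual to a. *)
Definition dual_frame (a : 'I_n -> one_form) (j : 'I_n) (p : M) : tangent p :=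
  row j (invmx (coframe_mx a p)).

(* The coefficient f_j in df = \sum_j f_j a^j. *)
Definition dir_deriv (a : 'I_n -> one_form) (j : 'I_n) (f : M -> K) (p : M) : K :=
  pairing (differential f p) (dual_frame a j p).

Lemma coframe_mx_unit (a : 'I_n -> one_form) (p : M) :
  coframing a -> coframe_mx a p \in unitmx.
Proof.
move=> [_ /(_ p) ab].
rewrite -unitmx_tr -row_free_unit -kermx_eq0; apply/rowV0P => u /sub_kermxP uB.
have /freeP fr := basis_free ab.
apply/rowP => i; rewrite mxE; apply: (fr (fun j => u 0 j)).
apply/matrixP => k l; rewrite ord1 summxE mxE.
move/matrixP/(_ 0 k): uB; rewrite !mxE => uB; rewrite -[RHS]uB.
by apply: eq_bigr => j _; rewrite -tnth_nth tnth_mktuple !mxE.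
Qed.

Lemma differentialE (a : 'I_n -> one_form) (f : M -> K) (p : M) :
  coframing a -> differential f p = \sum_j dir_deriv a j f p *: a j p.
Proof.
move=> /(coframe_mx_unit p) uB.
rewrite -[LHS](mulKVmx uB); apply/matrixP => k l; rewrite ord1 summxE mxE.
apply: eq_bigr => j _; rewrite /dir_deriv /pairing /dual_frame -row_mul !mxE mulrC.
by [].
Qed.

(* The tangent distribution of the foliation {a = 0, b = 0}. *)
Definition foliation (a b : one_form) (p : M) : set (tangent p) :=
  [set v | pairing (a p) v = 0 /\ pairing (b p) v = 0].

Definition bundle_map := forall p : M, {linear cotangent p -> cotangent p}.

Definition smooth_bundle_map (A : bundle_map) : Prop :=
  forall a : one_form, smooth_form a -> smooth_form (fun p => A p (a p)).

Definition bundle_map_sends (A : bundle_map) (a b : 'I_n -> one_form) : Prop :=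
  forall i p, b i p = A p (a i p).

(* Row i of the matrix of A lists the coefficients of A(a^i) in the coframe a. *)
Definition bundle_map_has_mx (A : bundle_map) (a : 'I_n -> one_form)
    (m : M -> 'M[K]_n) : Prop :=
  forall i p, A p (a i p) = \sum_j m p i j *: a j p.

End Manifold.

Arguments one_form {K n} M.
Arguments bundle_map {K n} M.
Arguments foliation {K n M} a b p.

(* The indices 1, 2, 3. *)
Definition i1 : 'I_3 := @Ordinal 3 0 isT.
Definition i2 : 'I_3 := @Ordinal 3 1 isT.
Definition i3 : 'I_3 := @Ordinal 3 2 isT.

Section Structures.
Context {K : realType} {M : manifold K 3}.
Implicit Types (R I J : M -> K) (alpha omega : 'I_3 -> one_form M).

Definition Cartan_structure R alpha : Prop :=
  [/\ smooth_fun R, coframing alpha &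
   forall p,
   [/\ ext_deriv (alpha i1) p = wedge (alpha i2 p) (alpha i3 p),
       ext_deriv (alpha i2) p = - wedge (alpha i1 p) (alpha i3 p) &
       ext_deriv (alpha i3) p = R p *: wedge (alpha i1 p) (alpha i2 p)]].

(* (I, J, 1)-generalized Finsler structure *)
Definition Finsler_structure I J omega : Prop :=
  [/\ smooth_fun I, smooth_fun J, coframing omega &
   forall p,
   [/\ ext_deriv (omega i1) p =
         - (I p *: wedge (omega i1 p) (omega i3 p))
         + wedge (omega i2 p) (omega i3 p),
       ext_deriv (omega i2) p = - wedge (omega i1 p) (omega i3 p) &
       ext_deriv (omega i3) p =
         wedge (omega i1 p) (omega i2 p)
         - J p *: wedge (omega i1 p) (omega i3 p)]].

Definition foliation_condition alpha omega : Prop :=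
  forall p, foliation (omega i1) (omega i3) p = foliation (alpha i1) (alpha i2) p.

Definition identification_condition alpha omega : Prop :=
  forall p, omega i1 p = alpha i1 p /\ omega i3 p = alpha i2 p.

Definition Cartan_Finsler_mx I J (p : M) : 'M[K]_3 :=
  \matrix_(i, j) nth 0 (nth [::] [:: [:: 1;   0;   0];
                                     [:: I p; J p; -1];
                                     [:: 0;   1;   0]] i) j.

End Structures.

(* Main.v *)
Require Import Defs.
From HB Require Import structures.
From mathcomp Require Import all_boot all_order all_algebra.
From mathcomp Require Import all_classical all_reals all_analysis.
From mathcomp Require Import ring lra.

Set Implicit Arguments.
Unset Strict Implicit.
Unset Printing Implicit Defensive.

Import Order.TTheory GRing.Theory Num.Theory.
Import numFieldNormedType.Exports.
Local Open Scope classical_set_scope.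
Local Open Scope ring_scope.

(** Once omega^1 = alpha^1 and omega^3 = alpha^2, the structure equations
determine omega^2.  Writing it in the coframe alpha, the two expressions for d omega^1 = d alpha^1, namely
  alpha^2 /\ alpha^3 = - I alpha^1 /\ alpha^2 + omega^2 /\ alpha^2,
give the coefficients I and -1 of alpha^1 and alpha^3, and the two expressions
for d omega^3 = d alpha^2 give the coefficient J of alpha^2 ([omega2E]).
Exterior differentiation of omega^2 + alpha^3 = I alpha^1 + J alpha^2 and
comparison of the coefficients of alpha^1 /\ alpha^2 then yield
- 1 + R = - I_2 + J_1 ([curvatureE]).  The first part is linear algebra at each
point, done by evaluating 2-covectors on the dual frame; the second needs the
Leibniz rule for the exterior derivative ([ext_derivZ]).

The bundle map itself is the change of coframe, which is unique because a
linear map is determined on a basis.  That it sends smooth forms to smooth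
forms ([smooth_coframe_change]) is the analytic part.  In a chart its matrix
is B_omega *m invmx B_alpha, where B_a has the local components of the a^i as
columns, and smooth functions are closed under the operations of Cramer's rule
([smooth_invmx]).  B_alpha is invertible in every chart by the chain rule for
transition maps ([jacobian_transition_unit]). *)

(** * Locality of the differential *)

Section LocalDifferential.
Context {K : realType} {V W : normedModType K}.

Lemma near_eq_expansion (f g : V -> W) (x : V) :
  (\near x, f x = g x) -> differentiable f x ->
  g \o shift x = cst (g x) + 'd f x +o_ 0 id.
Proof.
move=> fg /diff_locally; rewrite -(nbhs_singleton fg) => /eqaddoP dfx.
apply/eqaddoP => e e0; move: fg; rewrite (near_shift 0) subr0 => fg.
by apply: filterS2 fg (dfx e e0) => y /= fgy; rewrite !fctE /= fgy.
Qed.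

Lemma near_eq_diff (f g : V -> W) (x : V) :
  (\near x, f x = g x) -> differentiable f x -> 'd g x = 'd f x :> (V -> W).
Proof.
move=> fg dfx; apply: diff_unique; first exact: diff_continuous.
exact: near_eq_expansion.
Qed.

Lemma near_eq_differentiable (f g : V -> W) (x : V) :
  (\near x, f x = g x) -> differentiable f x -> differentiable g x.
Proof.
move=> fg dfx; apply/diff_locallyP; rewrite (near_eq_diff fg dfx).
by split; [exact: diff_continuous|exact: near_eq_expansion].
Qed.

End LocalDifferential.

Lemma differentiable_rV (K : realType) (V : normedModType K) n
    (f : V -> 'rV[K]_n) (x : V) :
  (forall i, differentiable (fun y => f y 0 i) x) -> differentiable f x.
Proof.
move=> df.
have -> : f = \sum_(i < n) (fun y => f y 0 i *: delta_mx 0 i).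
  by apply/funext => y; rewrite fct_sumE [LHS]row_sum_delta.
by apply: differentiable_sum => i; exact: differentiableZl.
Qed.

(** The chain rule for g \o f = id; the Jacobians appear in this order because
they act on row vectors. *)
Lemma jacobian_inverse (K : realType) n (f g : 'rV[K]_n -> 'rV[K]_n)
    (x : 'rV[K]_n) :
  differentiable f x -> differentiable g (f x) -> (\near x, g (f x) = x) ->
  'J f x *m 'J g (f x) = 1%:M.
Proof.
move=> df dg gf; apply/row_matrixP => i; rewrite row_mul rowE.
rewrite !mul_rV_lin1/= -[LHS]/(('d g (f x) \o 'd f x) (delta_mx 0 i)).
rewrite -(diff_comp df dg) -(@near_eq_diff _ _ _ _ id x gf).
  by rewrite diff_val rowE mulmx1.
exact: differentiable_comp.
Qed.

(** * Smooth functions on an open set *)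

Section SmoothCalculus.
Context {K : realType} {n : nat}.
Variable U : set 'rV[K]_n.
Hypothesis oU : open U.
Implicit Types (f g : 'rV[K]_n -> K).

(** Openness of U is what lets a pointwise equality on U pass to the partial
derivatives.  The rules of differentiation below hold on U only, so the
closure properties go through this lemma. *)
Lemma Ck_on_congr k f g : (forall x, U x -> f x = g x) ->
  Ck_on k U f -> Ck_on k U g.
Proof.
have nearU (h1 h2 : 'rV[K]_n -> K) (x : 'rV[K]_n) :
    (forall x, U x -> h1 x = h2 x) -> U x -> \near x, h1 x = h2 x.
  by move=> h12 Ux; apply: filterS (open_nbhs_nbhs (conj oU Ux)).
elim: k f g => [|k IH] f g fg /=.
  move=> cf x Ux; suff : g @ x --> f x by rewrite (fg x Ux).
  apply: cvg_trans (cf x Ux); apply: (near_eq_cvg (F := nbhs x)).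
  exact: (nearU _ _ _ fg Ux).
move=> [df pf]; split=> [x Ux|i].
  exact: near_eq_differentiable (nearU _ _ _ fg Ux) (df x Ux).
by apply: IH (pf i) => x Ux; apply: near_eq_derive; apply: nearU.
Qed.

Lemma Ck_onS k f : Ck_on k.+1 U f -> Ck_on k U f.
Proof.
elim: k f => [|k IH] f [df pf] /=.
  by move=> x Ux; apply/differentiable_continuous/df.
by split=> // i; apply: IH.
Qed.

Lemma smooth_congr f g : (forall x, U x -> f x = g x) ->
  smooth_on U f -> smooth_on U g.
Proof. by move=> fg sf k; apply: Ck_on_congr fg (sf k). Qed.

Lemma smooth_differentiable f x : smooth_on U f -> U x -> differentiable f x.
Proof. by move=> sf; have [+ _] := sf 1%N; apply. Qed.

Lemma smooth_cst (a : K) : smooth_on U (cst a).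
Proof.
move=> k; elim: k a => [|k IH] a; first by move=> x Ux; exact: cst_continuous.
split=> [x _|i]; first exact: differentiable_cst.
by apply: Ck_on_congr (IH 0) => x _; rewrite /partial derive_cst.
Qed.

Lemma Ck_onD k f g : Ck_on k U f -> Ck_on k U g -> Ck_on k U (f + g).
Proof.
elim: k f g => [|k IH] f g.
  by move=> cf cg x Ux; apply: continuousD; [exact: cf|exact: cg].
move=> [df pf] [dg pg]; split=> [x Ux|i].
  by apply: differentiableD; [exact: df|exact: dg].
apply: Ck_on_congr (IH _ _ (pf i) (pg i)) => x Ux.
by rewrite /partial deriveD//; apply: diff_derivable; [exact: df|exact: dg].
Qed.

Lemma Ck_onM k f g : Ck_on k U f -> Ck_on k U g -> Ck_on k U (f * g).
Proof.
elim: k f g => [|k IH] f g.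
  by move=> cf cg x Ux; apply: continuousM; [exact: cf|exact: cg].
move=> Sf Sg; have [df pf] := Sf; have [dg pg] := Sg; split=> [x Ux|i].
  by apply: differentiableM; [exact: df|exact: dg].
have := Ck_onD (IH _ _ (Ck_onS Sf) (pg i)) (IH _ _ (Ck_onS Sg) (pf i)).
apply: Ck_on_congr => x Ux; rewrite /partial deriveM//.
  by apply: diff_derivable; exact: df.
by apply: diff_derivable; exact: dg.
Qed.

(** The derivative - f^-2 f' of 1/f involves 1/f at one order of
differentiability less, so the induction closes by the product rule. *)
Lemma Ck_onV k f : (forall x, U x -> f x != 0) ->
  Ck_on k U f -> Ck_on k U (fun x => (f x)^-1).
Proof.
move=> f0; elim: k => [|k IH].
  by move=> cf x Ux; apply: continuousV; [exact: f0|exact: cf].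
move=> Sf; have [df pf] := Sf; split=> [x Ux|i].
  by apply: differentiableV; [exact: df|exact: f0].
have Vk := IH (Ck_onS Sf).
have := Ck_onM (smooth_cst (-1) k) (Ck_onM (Ck_onM Vk Vk) (pf i)).
apply: Ck_on_congr => x Ux; rewrite /partial deriveV ?f0//.
  by rewrite -exprVn expr2 scaleNr; exact: mulN1r.
by apply: diff_derivable; exact: df.
Qed.

Lemma smoothD f g : smooth_on U f -> smooth_on U g -> smooth_on U (f + g).
Proof. by move=> sf sg k; apply: Ck_onD. Qed.

Lemma smoothM f g : smooth_on U f -> smooth_on U g -> smooth_on U (f * g).
Proof. by move=> sf sg k; apply: Ck_onM. Qed.

Lemma smoothV f : (forall x, U x -> f x != 0) -> smooth_on U f ->
  smooth_on U (fun x => (f x)^-1).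
Proof. by move=> f0 sf k; apply: Ck_onV. Qed.

Lemma smooth_sum (T : Type) (r : seq T) (P : pred T) (F : T -> 'rV[K]_n -> K) :
  (forall i, smooth_on U (F i)) ->
  smooth_on U (fun x => \sum_(i <- r | P i) F i x).
Proof.
move=> sF; elim: r => [|i r IH].
  by apply: smooth_congr (smooth_cst 0) => x _; rewrite big_nil.
have [Pi|nPi] := boolP (P i).
  by apply: smooth_congr (smoothD (sF i) IH) => x _; rewrite big_cons Pi.
by apply: smooth_congr IH => x _; rewrite big_cons (negPf nPi).
Qed.

Lemma smooth_prod (T : Type) (r : seq T) (P : pred T) (F : T -> 'rV[K]_n -> K) :
  (forall i, smooth_on U (F i)) ->
  smooth_on U (fun x => \prod_(i <- r | P i) F i x).
Proof.
move=> sF; elim: r => [|i r IH].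
  by apply: smooth_congr (smooth_cst 1) => x _; rewrite big_nil.
have [Pi|nPi] := boolP (P i).
  by apply: smooth_congr (smoothM (sF i) IH) => x _; rewrite big_cons Pi.
by apply: smooth_congr IH => x _; rewrite big_cons (negPf nPi).
Qed.

Definition smooth_mx m p (F : 'rV[K]_n -> 'M[K]_(m, p)) : Prop :=
  forall i j, smooth_on U (fun x => F x i j).

Lemma smooth_det m (F : 'rV[K]_n -> 'M[K]_m) :
  smooth_mx F -> smooth_on U (fun x => \det (F x)).
Proof.
move=> sF; apply: smooth_sum => s.
by apply: (smoothM (smooth_cst _)); apply: smooth_prod.
Qed.

Lemma smooth_mulmx m p q (F : 'rV[K]_n -> 'M[K]_(m, p))
    (G : 'rV[K]_n -> 'M[K]_(p, q)) :
  smooth_mx F -> smooth_mx G -> smooth_mx (fun x => F x *m G x).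
Proof.
move=> sF sG i j; have := smooth_sum (index_enum _) xpredT
  (fun l => smoothM (sF i l) (sG l j)).
by apply: smooth_congr => x _; rewrite mxE.
Qed.

(** Cramer's rule: the entries are minors divided by the determinant. *)
Lemma smooth_invmx m (F : 'rV[K]_n -> 'M[K]_m) :
  (forall x, U x -> F x \in unitmx) -> smooth_mx F ->
  smooth_mx (fun x => invmx (F x)).
Proof.
move=> uF sF i j.
have sadj : smooth_on U (fun x => (\adj (F x)) i j).
  have sminor : smooth_on U (fun x => \det (row' j (col' i (F x)))).
    apply: smooth_det => k l.
    by apply: smooth_congr (sF (lift j k) (lift i l)) => x _; rewrite !mxE.
  apply: smooth_congr (smoothM (smooth_cst ((-1) ^+ (j + i))) sminor) => x _.
  by rewrite mxE.
have sdetV : smooth_on U (fun x => (\det (F x))^-1).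
  apply: smoothV (smooth_det sF) => x Ux.
  by rewrite -unitfE -unitmxE uF.
apply: smooth_congr (smoothM sdetV sadj) => x Ux.
by rewrite /invmx uF// mxE.
Qed.

End SmoothCalculus.

(** * Charts and transition maps *)

Section ManifoldCalculus.
Context {K : realType} {n : nat} {M : manifold K n}.
Implicit Types (c d : chart K n M) (p : M) (a b : one_form M) (f : M -> K).

Lemma chart_at_atlas p : atlas (chart_at p).
Proof. by rewrite /chart_at; case: cid => c []. Qed.

Lemma chart_at_dom p : chart_dom (chart_at p) p.
Proof. by rewrite /chart_at; case: cid => c []. Qed.

Lemma transition_differentiable c d p : atlas c -> atlas d ->
  chart_dom c p -> chart_dom d p ->
  differentiable (transition c d) (chart_map c p).
Proof.
move=> ac ad cp dp; apply: differentiable_rV => i.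
apply: smooth_differentiable (atlas_compat ac ad i) _.
by split; [exact: chart_mapP|rewrite /preimage /= chart_mapK].
Qed.

Lemma transitionK c d p : chart_dom c p -> chart_dom d p ->
  \forall x \near chart_map c p, transition d c (transition c d x) = x.
Proof.
move=> cp dp; have cx := chart_mapP cp.
have nc := open_nbhs_nbhs (conj (@chart_img_open _ _ _ c) cx).
have nd : \forall x \near chart_map c p, chart_dom d (chart_inv c x).
  have dd : nbhs (chart_inv c (chart_map c p)) (chart_dom d).
    by rewrite chart_mapK//; apply: open_nbhs_nbhs (conj (@chart_dom_open _ _ _ d) dp).
  exact: (chart_inv_cont cx) dd.
apply: filterS2 nc nd => x cx' dx.
by rewrite /transition /= chart_mapK// chart_invK.
Qed.

Lemma jacobian_transition_unit c d p : atlas c -> atlas d ->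
  chart_dom c p -> chart_dom d p ->
  'J (transition c d) (chart_map c p) \in unitmx.
Proof.
move=> ac ad cp dp.
have tE : transition c d (chart_map c p) = chart_map d p.
  by rewrite /transition /= chart_mapK.
have := jacobian_inverse (transition_differentiable ac ad cp dp) _
  (transitionK cp dp).
rewrite tE => /(_ (transition_differentiable ad ac dp cp)) JK.
exact: (mulmx1_unit JK).1.
Qed.

(** The local expression of a form at p in the preferred chart of p is computed
with this Jacobian, so it returns the components that define the covector. *)
Lemma jacobian_transition_refl c p : chart_dom c p ->
  'J (transition c c) (chart_map c p) = 1%:M.
Proof.
move=> cp; have nc := open_nbhs_nbhs (conj (@chart_img_open _ _ _ c) (chart_mapP cp)).
apply/row_matrixP => i; rewrite !rowE mul_rV_lin1/=.
rewrite (@near_eq_diff _ _ _ id) ?diff_val ?mulmx1//.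
by apply: filterS nc => x cx; rewrite /transition /= chart_invK.
Qed.

Lemma local_expr_chart_at a p i :
  local_expr (chart_at p) a i (chart_map (chart_at p) p) = (a p : 'cV[K]_n) i 0.
Proof.
rewrite /local_expr chart_mapK; last exact: chart_at_dom.
rewrite /components jacobian_transition_refl ?mul1mx//; exact: chart_at_dom.
Qed.

(** The two identities below hold at every x, in or out of the chart image,
because components are linear in the covector for any Jacobian; they can thus
be differentiated without any locality argument. *)
Lemma local_exprD c a b i x :
  local_expr c (fun q => a q + b q) i x = local_expr c a i x + local_expr c b i x.
Proof. by rewrite /local_expr /components mulmxDr mxE. Qed.

Lemma local_exprZ c f a i x :
  local_expr c (fun q => f q *: a q) i x
  = f (chart_inv c x) * local_expr c a i x.
Proof. by rewrite /local_expr /components -scalemxAr mxE. Qed.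

(** * The exterior derivative *)

Lemma smooth_form_differentiable a p i : smooth_form a ->
  differentiable (local_expr (chart_at p) a i) (chart_map (chart_at p) p).
Proof.
move=> /(_ _ (chart_at_atlas p) i) sa; apply: smooth_differentiable sa _.
exact/chart_mapP/chart_at_dom.
Qed.

Lemma smooth_fun_differentiable f p : smooth_fun f ->
  differentiable (f \o chart_inv (chart_at p)) (chart_map (chart_at p) p).
Proof.
move=> /(_ _ (chart_at_atlas p)) sf; apply: smooth_differentiable sf _.
exact/chart_mapP/chart_at_dom.
Qed.

Lemma smooth_formZ f a : smooth_fun f -> smooth_form a ->
  smooth_form (fun q => f q *: a q).
Proof.
move=> sf sa c ac i.
have := smoothM (@chart_img_open _ _ _ c) (sf c ac) (sa c ac i).
by apply: smooth_congr; [exact: (@chart_img_open _ _ _ c)|move=> x _; rewrite local_exprZ].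
Qed.

Lemma ext_derivD a b p : smooth_form a -> smooth_form b ->
  ext_deriv (fun q => a q + b q) p = ext_deriv a p + ext_deriv b p.
Proof.
move=> sa sb; apply/matrixP => i j; rewrite !mxE /partial.
have dD k l : 'D_(delta_mx 0 l)
      (local_expr (chart_at p) (fun q => a q + b q) k)
      (chart_map (chart_at p) p) =
    'D_(delta_mx 0 l) (local_expr (chart_at p) a k) (chart_map (chart_at p) p) +
    'D_(delta_mx 0 l) (local_expr (chart_at p) b k) (chart_map (chart_at p) p).
  rewrite -deriveD; last 2 first.
  - exact/diff_derivable/smooth_form_differentiable.
  - exact/diff_derivable/smooth_form_differentiable.
  by congr ('D_ _ _ _); apply/funext => x; rewrite local_exprD.
by rewrite !dD opprD addrACA.
Qed.

Lemma ext_derivZ f a p : smooth_fun f -> smooth_form a ->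
  ext_deriv (fun q => f q *: a q) p
  = wedge (differential f p) (a p) + f p *: ext_deriv a p.
Proof.
move=> sf sa; apply/matrixP => i j; rewrite !mxE /partial.
have dM k l : 'D_(delta_mx 0 l)
      (local_expr (chart_at p) (fun q => f q *: a q) k)
      (chart_map (chart_at p) p) =
    f p * 'D_(delta_mx 0 l) (local_expr (chart_at p) a k)
            (chart_map (chart_at p) p) +
    (a p : 'cV[K]_n) k 0 * (differential f p : 'cV_n) l 0.
  have -> : local_expr (chart_at p) (fun q => f q *: a q) k =
      (f \o chart_inv (chart_at p)) * local_expr (chart_at p) a k.
    by apply/funext => x; rewrite local_exprZ.
  rewrite deriveM; last 2 first.
  - exact/diff_derivable/smooth_fun_differentiable.
  - exact/diff_derivable/smooth_form_differentiable.
  by rewrite local_expr_chart_at /= chart_mapK ?mxE//; exact: chart_at_dom.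
by rewrite !dM !big_ord1 !mxE /partial; ring.
Qed.

(** * Evaluation of 2-covectors on vectors *)

Definition eval2 p (w : two_covector p) (u v : tangent p) : K :=
  ((u : 'rV_n) *m (w : 'M[K]_n) *m (v : 'rV[K]_n)^T) 0 0.

Lemma eval2D p (w1 w2 : two_covector p) u v :
  eval2 (w1 + w2) u v = eval2 w1 u v + eval2 w2 u v.
Proof. by rewrite /eval2 mulmxDr mulmxDl mxE. Qed.

Lemma eval2N p (w : two_covector p) u v : eval2 (- w) u v = - eval2 w u v.
Proof. by rewrite /eval2 mulmxN mulNmx mxE. Qed.

Lemma eval2Z p k (w : two_covector p) u v :
  eval2 (k *: w) u v = k * eval2 w u v.
Proof. by rewrite /eval2 -scalemxAr -scalemxAl mxE. Qed.

Lemma eval2_wedge p (a b : cotangent p) (u v : tangent p) :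
  eval2 (wedge a b) u v =
  pairing a u * pairing b v - pairing b u * pairing a v.
Proof.
have mulE (x y : 'cV[K]_n) : eval2 (x *m y^T : two_covector p) u v =
    pairing (x : cotangent p) u * pairing (y : cotangent p) v.
  rewrite /eval2 mulmxA -mulmxA -trmx_mul /pairing mxE big_ord1.
  by congr (_ * _); rewrite mxE.
by rewrite /wedge eval2D eval2N !mulE.
Qed.

(** * Coframes and change of coframe *)

Lemma col_coframe_mx (a : 'I_n -> one_form M) i p : col i (coframe_mx a p) = (a i p : 'cV_n).
Proof. by apply/colP => k; rewrite !mxE. Qed.

Section Coframe.
Variable a : 'I_n -> one_form M.
Hypothesis ca : coframing a.

Lemma pairing_dual_frame i j p : pairing (a i p) (dual_frame a j p) = (i == j)%:R.
Proof.
rewrite /pairing /dual_frame -col_coframe_mx -row_mul colE mulmxA.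
by rewrite mulVmx ?coframe_mx_unit// mul1mx !mxE eqxx andbT eq_sym.
Qed.

Lemma cotangent_coframe p (w : cotangent p) :
  w = \sum_j pairing w (dual_frame a j p) *: a j p.
Proof.
rewrite -[LHS](mulKVmx (coframe_mx_unit p ca)).
apply/matrixP => k l; rewrite ord1 summxE mxE; apply: eq_bigr => j _.
by rewrite /pairing /dual_frame -row_mul !mxE mulrC.
Qed.

Definition local_coframe_mx (b : 'I_n -> one_form M) c (x : 'rV[K]_n) : 'M[K]_n :=
  \matrix_(i, j) local_expr c (b j) i x.

Lemma local_coframe_mxE (b : 'I_n -> one_form M) c x :
  local_coframe_mx b c x =
  'J (transition c (chart_at (chart_inv c x))) (chart_map c (chart_inv c x))
    *m coframe_mx b (chart_inv c x).
Proof.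
apply/matrixP => i j; rewrite mxE /local_expr /components [LHS]mxE [RHS]mxE.
by apply: eq_bigr => k _; rewrite [coframe_mx _ _ _ _]mxE.
Qed.

Definition coframe_change (b : 'I_n -> one_form M) p :
    {linear cotangent p -> cotangent p} :=
  mulmx (coframe_mx b p *m invmx (coframe_mx a p)).

Lemma coframe_change_sends (b : 'I_n -> one_form M) :
  bundle_map_sends (coframe_change b) a b.
Proof.
move=> i p; rewrite /coframe_change /= -!col_coframe_mx !colE.
by rewrite mulmxA mulmxKV//; exact: coframe_mx_unit.
Qed.

(** In a chart, with T the Jacobian towards the preferred chart of the point,
the local components of the coframes with pointwise matrices P_b and P_a form
T P_b and T P_a, and T cancels: T (P_b P_a^-1 w) = (T P_b) (T P_a)^-1 (T w).
The map x |-> T itself need not be smooth, nor even continuous, since the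
preferred chart is chosen point by point; only the three factors on the right
are smooth in x. *)
Lemma smooth_coframe_change (b : 'I_n -> one_form M) :
  (forall i, smooth_form (b i)) -> smooth_bundle_map (coframe_change b).
Proof.
move=> sb w sw c ac i; have oU := @chart_img_open _ _ _ c.
have cdom x : chart_img c x -> chart_dom c (chart_inv c x) by exact: chart_invP.
have Jc x : chart_img c x ->
    'J (transition c (chart_at (chart_inv c x))) (chart_map c (chart_inv c x))
      \in unitmx.
  move=> cx; apply: jacobian_transition_unit => //.
  - exact: chart_at_atlas.
  - exact: cdom.
  - exact: chart_at_dom.
have ua x : chart_img c x -> local_coframe_mx a c x \in unitmx.
  by move=> cx; rewrite local_coframe_mxE unitmx_mul Jc// coframe_mx_unit.
have sBa : smooth_mx (chart_img c) (local_coframe_mx a c).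
  move=> k l; apply: (smooth_congr oU) (ca.1 l c ac k) => x _.
  by rewrite mxE.
have sBb : smooth_mx (chart_img c) (local_coframe_mx b c).
  by move=> k l; apply: (smooth_congr oU) (sb l c ac k) => x _; rewrite mxE.
have sW : smooth_mx (chart_img c) (fun x => \col_k local_expr c w k x).
  by move=> k l; apply: (smooth_congr oU) (sw c ac k) => x _; rewrite mxE.
have := smooth_mulmx oU (smooth_mulmx oU sBb (smooth_invmx oU ua sBa)) sW.
move=> /(_ i 0); apply: (smooth_congr oU) => x cx.
have -> : \col_k local_expr c w k x = components c (w (chart_inv c x)).
  by apply/colP => k; rewrite mxE.
have invM (P Q : 'M[K]_n) : P \in unitmx -> Q \in unitmx ->
    invmx (P *m Q) = invmx Q *m invmx P.
  move=> uP uQ; have uPQ : P *m Q \in unitmx by rewrite unitmx_mul uP.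
  apply: (can_inj (mulKmx uPQ)); rewrite mulmxV// mulmxA.
  by rewrite mulmxK// mulmxV.
rewrite !local_coframe_mxE invM ?Jc ?coframe_mx_unit//.
by rewrite /local_expr /components /= !mulmxA mulmxKV ?Jc.
Qed.

Lemma bundle_map_unique (A B : bundle_map M) (b : 'I_n -> one_form M) :
  bundle_map_sends A a b -> bundle_map_sends B a b ->
  forall p (w : cotangent p), B p w = A p w.
Proof.
move=> sA sB p w; rewrite (cotangent_coframe w) !linear_sum.
by apply: eq_bigr => j _; rewrite !linearZ/= -sA -sB.
Qed.

End Coframe.

End ManifoldCalculus.

(** * Cartan and Finsler structures *)

Lemma sum_I3 (V : nmodType) (F : 'I_3 -> V) : \sum_i F i = F i1 + F i2 + F i3.
Proof.
rewrite !big_ord_recl big_ord0 addr0 addrA.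
by congr (F _ + F _ + F _); apply: val_inj.
Qed.

Lemma I3_ind (P : 'I_3 -> Prop) : P i1 -> P i2 -> P i3 -> forall i, P i.
Proof.
move=> P1 P2 P3 [[|[|[|//]]] lti].
- by rewrite (_ : Ordinal lti = i1)//; apply: val_inj.
- by rewrite (_ : Ordinal lti = i2)//; apply: val_inj.
- by rewrite (_ : Ordinal lti = i3)//; apply: val_inj.
Qed.

Section CartanFinsler.
Context {K : realType} {Sigma : manifold K 3}.
Context {R I J : Sigma -> K} {alpha omega : 'I_3 -> one_form Sigma}.
Hypothesis Cartan : Cartan_structure R alpha.
Hypothesis Finsler : Finsler_structure I J omega.
Hypothesis ident : identification_condition alpha omega.

Let alphaP : coframing alpha. Proof. by case: Cartan. Qed.
Let omegaP : coframing omega. Proof. by case: Finsler. Qed.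

Lemma omega1E : omega i1 = alpha i1.
Proof. by apply: functional_extensionality_dep => p; case: (ident p). Qed.

Lemma omega3E : omega i3 = alpha i2.
Proof. by apply: functional_extensionality_dep => p; case: (ident p). Qed.

Let evalE := (@eval2D K 3 Sigma, @eval2N K 3 Sigma, @eval2Z K 3 Sigma,
  @eval2_wedge K 3 Sigma, fun i j p => pairing_dual_frame alphaP i j p).

(** With (e_j) the frame dual to alpha, the (e_1, e_2) and (e_2, e_3) components of
d omega^1 = d alpha^1 give the first and third coefficients of omega^2, and the
(e_1, e_2) component of d omega^3 = d alpha^2 gives the second. *)
Lemma omega2E p :
  omega i2 p = I p *: alpha i1 p + J p *: alpha i2 p - alpha i3 p.
Proof.
have [_ _ /(_ p) [d1 d2 d3]] := Cartan.
have [_ _ _ /(_ p) [D1 D2 D3]] := Finsler.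
move: D1 D2 D3; rewrite !omega1E !omega3E d1 d2 => D1 _ D2.
have := congr1 (fun w =>
  eval2 w (dual_frame alpha i1 p) (dual_frame alpha i2 p)) D1.
have := congr1 (fun w =>
  eval2 w (dual_frame alpha i2 p) (dual_frame alpha i3 p)) D1.
have := congr1 (fun w =>
  eval2 w (dual_frame alpha i1 p) (dual_frame alpha i2 p)) D2.
rewrite /= !evalE /= => E2 E3 E1.
rewrite [LHS](cotangent_coframe alphaP) sum_I3.
have -> : pairing (omega i2 p) (dual_frame alpha i1 p) = I p by lra.
have -> : pairing (omega i2 p) (dual_frame alpha i2 p) = J p by lra.
have -> : pairing (omega i2 p) (dual_frame alpha i3 p) = -1 by lra.
by rewrite scaleN1r.
Qed.

(** The alpha^1 /\ alpha^2 coefficient of d(omega^2): the terms I d alpha^1 and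
J d alpha^2 contain alpha^3 and drop out, leaving - I_2 + J_1 from dI and dJ
and - R from - d alpha^3, while the Finsler structure equation makes it - 1. *)
Lemma curvatureE p :
  R p = - dir_deriv alpha i2 I p + dir_deriv alpha i1 J p + 1.
Proof.
have [_ _ /(_ p) [d1 d2 d3]] := Cartan.
have [sI sJ _ /(_ p) [_ D2 _]] := Finsler.
move: D2; rewrite !omega1E !omega3E => D2.
have [[sa _] [so _]] := (alphaP, omegaP).
(* Moving alpha^3 to the left leaves only sums and multiples by functions. *)
have form2 : (fun q => omega i2 q + alpha i3 q) =
    (fun q => I q *: alpha i1 q + J q *: alpha i2 q).
  by apply: functional_extensionality_dep => q; rewrite omega2E subrK.
have := congr1 (fun w => ext_deriv w p) form2.
rewrite /= !ext_derivD ?ext_derivZ //; do ?exact: smooth_formZ.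
rewrite d1 d2 d3 D2.
move=> /(congr1 (fun w =>
  eval2 w (dual_frame alpha i1 p) (dual_frame alpha i2 p))).
rewrite !evalE /= -!/(dir_deriv _ _ _ _) => E; lra.
Qed.

End CartanFinsler.

Unset Implicit Arguments.

Theorem proposition3p2 (K : realType) (Sigma : manifold K 3)
    (R I J : Sigma -> K) (alpha omega : 'I_3 -> one_form Sigma) :
  Cartan_structure R alpha ->
  Finsler_structure I J omega ->
  foliation_condition alpha omega ->
  identification_condition alpha omega ->
  (exists A : bundle_map Sigma,
    [/\ smooth_bundle_map A,
        bundle_map_sends A alpha omega,
        bundle_map_has_mx A alpha (Cartan_Finsler_mx I J) &
        forall B : bundle_map Sigma, bundle_map_sends B alpha omega ->
          forall p w, B p w = A p w]) /\
  (forall p, R p = - dir_deriv alpha i2 I p + dir_deriv alpha i1 J p + 1).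
Proof.
move=> Cartan Finsler _ ident; split; last first.
  exact: (curvatureE Cartan Finsler ident).
have [_ alphaP _] := Cartan; have [_ _ [so _] _] := Finsler.
have sends := coframe_change_sends alphaP omega.
exists (coframe_change alpha omega); split=> //.
- exact: smooth_coframe_change.
- move=> + p; apply: I3_ind; rewrite -sends sum_I3 !mxE /= ?scale0r ?scale1r.
  + by rewrite !addr0 (omega1E ident).
  + by rewrite scaleN1r; exact: omega2E Cartan Finsler ident p.
  + by rewrite add0r addr0 (omega3E ident).
- by move=> B sB p w; exact: bundle_map_unique sends sB p w.
Qed.
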